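(* Let $\mathfrak{g}$ be a complex simple Lie algebra of type $\mathsf A_2$, $\mathsf B_{\ell\ge3}$, $\mathsf D_{\ell\ge4}$, $\mathsf E_6$, $\mathsf E_7$, $\mathsf E_8$, $\mathsf F_4$ or $\mathsf G_2$ (i.e. of type different from $\mathsf{A}_{\ell\neq 2}$ and $\mathsf{C}_{\ell}$). If $f \in \mathrm{Hom}(\wedge^2 \mathfrak{g}, \mathfrak{g})$ and $\sigma \in \wedge^2 \mathfrak{g}^*$ satisfy $$0 = [f(x,y), z] + [f(y,z), x] + [f(z,x),y] + \sigma(x,y)\, z + \sigma(y,z)\, x + \sigma (z,x)\, y$$ for all $x, y, z \in \mathfrak{g}$, then $\sigma = 0$ and $f$ is a scalar multiple of the Lie bracket $[\,,\,]: \wedge^2 \mathfrak{g} \to \mathfrak{g}$.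
   Context: $\mathfrak g$ is a finite-dimensional complex simple Lie algebra and all maps are complex linear; an element of $\mathrm{Hom}(\wedge^2\mathfrak g,\mathfrak g)$ (resp. $\wedge^2\mathfrak g^*$) is viewed as an alternating bilinear map $\mathfrak g\times\mathfrak g\to\mathfrak g$ (resp. $\to\mathbb C$). *)

(* Defs.v *)
From HB Require Import structures.
From mathcomp Require Import all_boot all_order all_algebra.
From mathcomp Require Import reals complex.

Set Implicit Arguments.
Unset Strict Implicit.
Unset Printing Implicit Defensive.

Import GRing.Theory.
Local Open Scope ring_scope.

HB.mixin Record Vector_isLieAlgebra (F : fieldType) (L : Type)
    of Vector F L := {
  lie : {bilinear L -> L -> L};
  lie_alt : forall x : L, lie x x = 0;
  lie_jacobi : forall x y z : L,
    lie x (lie y z) + lie y (lie z x) + lie z (lie x y) = 0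
}.

#[short(type="lieAlgType")]
HB.structure Definition LieAlgebra (F : fieldType) :=
  { L of Vector F L & Vector_isLieAlgebra F L }.

Notation "[[ x , y ]]" := (lie x y)
  (at level 0, x at level 99, y at level 99, format "[[ x ,  y ]]")
  : ring_scope.

Section LieTheory.
Variables (F : fieldType) (L : lieAlgType F).

Definition lie_abelian (H : {vspace L}) : Prop :=
  forall x y : L, x \in H -> y \in H -> [[x, y]] = 0.

Definition lie_ideal (I : {vspace L}) : Prop :=
  forall x y : L, y \in I -> [[x, y]] \in I.

Definition lie_simple : Prop :=
  ~ lie_abelian fullv /\
  forall I : {vspace L}, lie_ideal I -> I = 0%VS \/ I = fullv.

Definition ad_diagonalizable (h : L) : Prop :=
  exists X : (\dim {:L}).-tuple L,
    basis_of fullv X /\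
    forall x, x \in X -> exists a : F, [[h, x]] = a *: x.

(* For semisimple L over an algebraically closed field of characteristic 0,
   these are exactly the Cartan subalgebras (equivalently, the maximal toral
   subalgebras); the definition is not meant for other Lie algebras. *)
Definition cartan_subalgebra (H : {vspace L}) : Prop :=
  [/\ lie_abelian H,
      forall x : L, (forall h, h \in H -> [[h, x]] = 0) -> x \in H &
      forall h, h \in H -> ad_diagonalizable h].

Definition dual (H : {vspace L}) := 'Hom(subvs_of H, F^o).

Definition in_root_space (H : {vspace L}) (alpha : dual H) (x : L) : Prop :=
  forall h : subvs_of H, [[vsval h, x]] = (alpha h : F) *: x.

Definition is_root (H : {vspace L}) (alpha : dual H) : Prop :=
  alpha != 0 /\ exists2 x : L, x != 0 & in_root_space alpha x.

Definition is_root_base (H : {vspace L}) (l : nat)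
    (alpha : l.-tuple (dual H)) : Prop :=
  [/\ basis_of fullv alpha,
      forall i, is_root (tnth alpha i) &
      forall beta : dual H, is_root beta -> exists k : 'I_l -> nat,
        beta = \sum_(i < l) (k i)%:R *: tnth alpha i \/
        beta = - \sum_(i < l) (k i)%:R *: tnth alpha i].

Definition is_coroot (H : {vspace L}) (alpha : dual H) (h : subvs_of H)
    : Prop :=
  alpha h = 2 /\
  exists e f : L,
    [/\ in_root_space alpha e, in_root_space (- alpha) f
      & [[e, f]] = vsval h].

End LieTheory.

Inductive dynkin_type : Type :=
  | TypeA of nat | TypeB of nat | TypeC of nat | TypeD of nat | TypeE of nat
  | TypeF4 | TypeG2.

Definition dynkin_rank (t : dynkin_type) : nat :=
  match t with
  | TypeA l | TypeB l | TypeC l | TypeD l | TypeE l => l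
  | TypeF4 => 4
  | TypeG2 => 2
  end.

(* Nodes are numbered as in Bourbaki, but from 0.  [dynkin_edge t i j] says
   that nodes i < j are joined, whatever the multiplicity of the bond. *)
Definition dynkin_edge (t : dynkin_type) (i j : nat) : bool :=
  match t with
  | TypeD l =>
      (j == i.+1) && (j.+1 < l)%N || (i.+3 == l) && (j.+1 == l)
  | TypeE _ =>
      if (i < 2)%N then j == i.+2 else j == i.+1
  | _ => j == i.+1
  end.

(* The (i, j) entry is <alpha_i, alpha_j^vee> =
   2 (alpha_i, alpha_j) / (alpha_j, alpha_j), so that an entry below -1 occurs
   for alpha_i long and alpha_j short. *)
Definition cartan_entry (t : dynkin_type) (i j : nat) : int :=
  if i == j then 2
  else if ~~ (dynkin_edge t i j || dynkin_edge t j i) then 0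
  else match t with
       | TypeB l => if j.+1 == l then - 2 else - 1
       | TypeC l => if i.+1 == l then - 2 else - 1
       | TypeF4 => if (i == 1) && (j == 2) then - 2 else - 1
       | TypeG2 => if i == 1 then - 3 else - 1
       | _ => - 1
       end.

Definition has_dynkin_type (F : fieldType) (L : lieAlgType F)
    (t : dynkin_type) : Prop :=
  exists (H : {vspace L}) (alpha : (dynkin_rank t).-tuple (dual H))
         (h : (dynkin_rank t).-tuple (subvs_of H)),
    [/\ cartan_subalgebra H,
        is_root_base alpha,
        forall i, is_coroot (tnth alpha i) (tnth h i) &
        forall i j, tnth alpha i (tnth h j) = (cartan_entry t i j)%:~R].

Definition type_not_A_neq2_nor_C (t : dynkin_type) : Prop :=
  match t with
  | TypeA l => l = 2
  | TypeB l => (3 <= l)%N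
  | TypeC _ => False
  | TypeD l => (4 <= l)%N
  | TypeE l => (6 <= l <= 8)%N
  | TypeF4 | TypeG2 => True
  end.

(* Main.v *)
(* The hypothesis says that F(x,y) = ad f(x,y) + sigma(x,y) id satisfies the
   first Bianchi identity.  Pairing it with the Killing form k, the classical
   octahedron argument computes k(f(x,y),[z,w]) - k(f(z,w),[x,y]) in terms of
   sigma and k.
   If [x,y] = [z,w] = 0 this is a linear relation on sigma alone; for root
   vectors y, z of non-orthogonal roots, with x, w in the Cartan subalgebra H, it
   gives sigma(y,z) = 0.  The solutions (f,sigma) form a g-module and, for h <> 0
   in H, g is generated by [h,g] (in fact g = [h,g] + [[h,g],[h,g]], an ideal), so
   sigma = 0.
   Then k(f(x,y),[z,w]) is symmetric under exchange of the pairs, so that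
   f = phi o [,] with phi k-symmetric.  The Bianchi identity forces phi to
   preserve root spaces and, by the same generation argument, to commute with
   every ad x; hence phi is a scalar.
   Only rank >= 2 is used, and the integrality of the roots on one coroot, which
   makes k nondegenerate. *)
Require Import Defs.
From HB Require Import structures.
From mathcomp Require Import all_boot all_order all_algebra.
From mathcomp Require Import reals complex.
From mathcomp Require Import ring.

Set Implicit Arguments.
Unset Strict Implicit.
Unset Printing Implicit Defensive.

Import GRing.Theory.
Local Open Scope ring_scope.

Import Num.Theory passmx.

Lemma basis_neq0 (F : fieldType) (V : vectType F) (U : {vspace V}) n
    (X : n.-tuple V) (i : 'I_n) : basis_of U X -> X`_i != 0.
Proof.
by move/basis_free/free_not0; apply; apply: mem_nth; rewrite size_tuple.
Qed.

(** * Adjoint representation and Killing form *)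

Section KillingForm.
Variables (F : fieldType) (g : lieAlgType F).
Implicit Types x y z u v w : g.

Lemma lieC x y : [[x, y]] = - [[y, x]].
Proof.
have := lie_alt (x + y); rewrite linearDl !linearDr /= !lie_alt addr0 add0r.
by move/eqP; rewrite addr_eq0 => /eqP.
Qed.

Lemma lie_derivation x y z :
  [[x, [[y, z]]]] = [[[[x, y]], z]] + [[y, [[x, z]]]].
Proof.
have /eqP := lie_jacobi x y z; rewrite -addrA addr_eq0 => /eqP ->.
by rewrite opprD -linearNr -lieC -lieC addrC.
Qed.

Definition ad x : 'End(g) := linfun (lie x).

Lemma adE x y : ad x y = [[x, y]].
Proof. by rewrite lfunE. Qed.

Lemma ad_linear : linear ad.
Proof.
by move=> a x y; apply/lfunP => z; rewrite add_lfunE scale_lfunE !adE linearPl.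
Qed.
HB.instance Definition _ :=
  GRing.isSemilinear.Build F g 'End(g) _ ad (GRing.semilinear_linear ad_linear).

Lemma ad_lie x y : ad [[x, y]] = (ad x \o ad y)%VF - (ad y \o ad x)%VF.
Proof.
apply/lfunP => z; rewrite add_lfunE opp_lfunE !comp_lfunE !adE.

by rewrite (lie_derivation x y z) addrK.
Qed.

Definition ad_mx x := mxof (vbasis {:g}) (vbasis {:g}) (ad x).

(** Matrices act on row vectors, so composition of endomorphisms reverses the order of the
    factors. *)
Lemma ad_mx_lie x y : ad_mx [[x, y]] = ad_mx y *m ad_mx x - ad_mx x *m ad_mx y.
Proof.
by rewrite /ad_mx ad_lie linearB /= !(mxof_comp _ _ (vbasisP _)).
Qed.

Definition killing x y : F := \tr (ad_mx x *m ad_mx y).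

Lemma killingC x y : killing x y = killing y x.
Proof. exact: mxtrace_mulC. Qed.

Lemma killing_linear x : scalar (killing x).
Proof.
by move=> a y z; rewrite /killing /ad_mx !linearP.
Qed.
HB.instance Definition _ x :=
  GRing.isSemilinear.Build F g F _ (killing x)
    (GRing.semilinear_linear (killing_linear x)).

Lemma killingA x y z : killing [[x, y]] z = killing x [[y, z]].
Proof.
rewrite /killing !ad_mx_lie mulmxBl mulmxBr !raddfB /= -!mulmxA.
by congr (_ - _); rewrite mxtrace_mulC mulmxA.
Qed.

Lemma killing_lieC x y z : killing [[x, y]] z = - killing y [[x, z]].
Proof. by rewrite killingC (lieC x) raddfN /= killingC killingA. Qed.

(** Square matrices stand for the tensor square of g, and this is the linear map on it induced by
    [b]; pure tensors are the rank-one matrices of [bilinear_mxE]. *)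
Definition bilinear_mx (b : {bilinear g -> g -> g}) (M : 'M[F]_(\dim {:g})) : g :=
  \sum_i \sum_j M i j *: b (vbasis {:g})`_i (vbasis {:g})`_j.

Lemma bilinear_mx_linear b : linear (bilinear_mx b).
Proof.
move=> k M N; rewrite /bilinear_mx scaler_sumr -big_split /=; apply: eq_bigr => i _.
rewrite scaler_sumr -big_split /=; apply: eq_bigr => j _.
by rewrite !mxE scalerDl scalerA.
Qed.
HB.instance Definition _ b :=
  GRing.isSemilinear.Build F 'M[F]_(\dim {:g}) g _ (bilinear_mx b)
    (GRing.semilinear_linear (bilinear_mx_linear b)).

Lemma bilinear_mxE b x y :
  bilinear_mx b (\matrix_(i, j) (coord (vbasis {:g}) i x * coord (vbasis {:g}) j y))
  = b x y.
Proof.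
rewrite {2}(coord_vbasis (memvf x)) linear_sumlz /bilinear_mx; apply: eq_bigr => i _.
rewrite {2}(coord_vbasis (memvf y)) linear_sumr; apply: eq_bigr => j _.
by rewrite mxE linearZl_LR linearZr_LR scalerA.
Qed.

End KillingForm.

(** * Ideals of a simple Lie algebra and generation by eigenvectors *)

Section SimpleLieAlgebra.
Variables (F : fieldType) (g : lieAlgType F).
Hypothesis g_simple : lie_simple g.
Implicit Types (x y z u v h : g) (a b c : F).

(** The line through a central element is an ideal; were it everything, g would be abelian. *)
Lemma centre_trivial y : (forall z, [[z, y]] = 0) -> y = 0.
Proof.
move=> y_central; case: g_simple => g_nonabelian g_ideals.
have y_line z : z \in <[y]>%VS -> forall x, [[x, z]] = 0.
  by case/vlineP=> k -> x; rewrite linearZ /= y_central scaler0.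
have /g_ideals [/eqP|y_full] : lie_ideal <[y]>%VS.
- by move=> x z /y_line ->; rewrite mem0v.
- by rewrite -subv0 => /subvP /(_ y (memv_line y)); rewrite memv0 => /eqP.
by case: g_nonabelian => x z _ _; apply: y_line; rewrite y_full memvf.
Qed.

Lemma ideal_full (I : {vspace g}) x :
  lie_ideal I -> x \in I -> x != 0 -> I = fullv.
Proof.
case: g_simple => _ g_ideals /g_ideals [->|//].
by rewrite memv0 => ->.
Qed.

(** The radical is an ideal by invariance, and a single non-zero value of the form keeps it from
    being all of g. *)
Lemma killing_nondegenerate x0 y0 : killing x0 y0 != 0 ->
  forall x, (forall y, killing x y = 0) -> x = 0.
Proof.
move=> xy0 x x_rad.
pose K y : 'Hom(g, F^o) := linfun (killing y : g -> F^o).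
have KE y z : K y z = killing y z by rewrite lfunE.
pose e := vbasis {:g}.
pose I := (\bigcap_(i < \dim {:g}) lker (K e`_i))%VS.
have IP z : reflect (forall y, killing z y = 0) (z \in I).
  apply: (iffP idP) => [zI y|z_rad].
    rewrite (coord_vbasis (memvf y)) raddf_sum big1 // => i _ /=.
    rewrite linearZ /= killingC -KE.
    have /subvP/(_ _ zI) : (I <= lker (K e`_i))%VS by exact: (bigcapv_inf i).
    by rewrite memv_ker => /eqP ->; rewrite mulr0.
  rewrite memvE; apply/subv_bigcapP => i _; rewrite -memvE memv_ker KE.
  by rewrite killingC z_rad.
have I_ideal : lie_ideal I.
  move=> y z /IP zI; apply/IP => u.
  by rewrite lieC killingC raddfN /= killingC killingA zI oppr0.
apply: contraNeq xy0 => x_neq0.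
have I_full := ideal_full I_ideal (introT (IP x) x_rad) x_neq0.
by apply/eqP; move: y0; apply/IP; rewrite I_full memvf.
Qed.

Lemma eig_lie h a b x y : [[h, x]] = a *: x -> [[h, y]] = b *: y ->
  [[h, [[x, y]]]] = (a + b) *: [[x, y]].
Proof.
move=> hx hy; rewrite lie_derivation hx hy scalerDl.
by rewrite linearZl_LR linearZ.
Qed.

Variables (X : (\dim {:g}).-tuple g) (lam : 'I_(\dim {:g}) -> F) (h : g).
Hypothesis X_basis : basis_of {:g} X.
Hypothesis X_eig : forall i : 'I_(\dim {:g}), [[h, X`_i]] = lam i *: X`_i.

(** This is [h, g], and [W] below is [V, V]; both are written as spans so that inclusions can be
    tested on the eigenbasis. *)
Let V := (\sum_(i | (lam i != 0)%R) <[X`_i]>)%VS.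
Let W :=
  (\sum_(i | (lam i != 0)%R) \sum_(j | (lam j != 0)%R) <[ [[X`_i, X`_j]]%R ]>)%VS.

Let coordX x : x = \sum_i coord X i x *: X`_i.
Proof. by rewrite -(coord_basis X_basis) ?memvf. Qed.

Let X_V i : lam i != 0 -> X`_i \in V.
Proof. by move=> i0; apply/(sumv_sup i)/memv_line. Qed.

Let eig_V a z : [[h, z]] = a *: z -> a != 0 -> z \in V.
Proof.
move=> hz a0; have -> : z = a^-1 *: [[h, z]] by rewrite hz scalerA mulVf ?scale1r.
rewrite memvZ // (coordX z) linear_sumr memv_suml // => i _.
rewrite linearZr_LR /= X_eig; have [->|i0] := eqVneq (lam i) 0.
  by rewrite scale0r scaler0 mem0v.
by rewrite !memvZ ?X_V.
Qed.

Let lie_VV u v : u \in V -> v \in V -> [[u, v]] \in W.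
Proof.
move=> uV vV; have : (V <= ad u @^-1: W)%VS.
  apply/subv_sumP => i i0; rewrite -memvE -memv_preim adE lieC memvN -adE memv_preim.
  apply/subvP: u uV; apply/subv_sumP => j j0.
  rewrite -memvE -memv_preim adE.
  by apply/(sumv_sup i)/(sumv_sup j)/memv_line.
by move/subvP/(_ v vV); rewrite -memv_preim adE.
Qed.

(** If [lam i] is 0, bracketing with the i-th eigenvector preserves eigenvalues, hence V and, by
    derivation, W. Otherwise that eigenvector lies in V. A generator of W has eigenvalue
    [lam j + lam k]: if this is non-zero the generator lies in V, and if it is zero the bracket has
    eigenvalue [lam i] and falls back into V. *)
Let VW_basis (i : 'I_(\dim {:g})) y : y \in (V + W)%VS -> [[X`_i, y]] \in (V + W)%VS.
Proof.
suff /subvP VWi : (V + W <= ad X`_i @^-1: (V + W))%VS.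
  by move/VWi; rewrite -memv_preim adE.
have inV z : z \in V -> z \in (V + W)%VS by apply/subvP/addvSl.
have inW z : z \in W -> z \in (V + W)%VS by apply/subvP/addvSr.
rewrite subv_add; apply/andP; split; apply/subv_sumP => j j0.
  rewrite -memvE -memv_preim adE.
  have [i0|i0] := eqVneq (lam i) 0; last by rewrite inW ?lie_VV ?X_V.
  by apply/inV/eig_V/j0; rewrite -[lam j]add0r -i0; apply: eig_lie.
apply/subv_sumP => k k0; rewrite -memvE -memv_preim adE.
have eig_jk := eig_lie (X_eig j) (X_eig k).
have [i0|i0] := eqVneq (lam i) 0.
  have eig_i l : lam l != 0 -> [[X`_i, X`_l]] \in V.
    by apply/eig_V; rewrite -[lam l]add0r -i0; apply: eig_lie.
  by rewrite lie_derivation; apply/inW/memvD; apply: lie_VV; rewrite ?eig_i ?X_V.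
have [jk0|jk0] := eqVneq (lam j + lam k) 0.
  apply/inV/eig_V/i0; rewrite -[lam i]addr0 -jk0.
  exact: eig_lie.
by apply/inW/lie_VV; [exact: X_V | apply: eig_V jk0].
Qed.

(* The ideal generated by [h, g] is [h, g] + [[h, g], [h, g]]. *)
Lemma eig_gen (P : g -> Prop) : h != 0 ->
    P 0 -> (forall a x y, P x -> P y -> P (a *: x + y)) ->
    (forall i : 'I_(\dim {:g}), lam i != 0 -> P X`_i) ->
    (forall i j : 'I_(\dim {:g}), lam i != 0 -> lam j != 0 -> P [[X`_i, X`_j]]) ->
  forall z, P z.
Proof.
move=> h0 P0 Plin PX PXX.
have Pline x : P x -> forall y, y \in <[x]>%VS -> P y.
  by move=> Px _ /vlineP [k ->]; rewrite -[_ *: _]addr0; apply: Plin.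
have Psum (I : finType) (Q : pred I) (U : I -> {vspace g}) :
    (forall i, Q i -> forall y, y \in U i -> P y) ->
    forall y, y \in (\sum_(i | Q i) U i)%VS -> P y.
  move=> PU y /memv_sumP [v vU ->]; apply: (big_ind P) => // [u w Pu Pw|i Qi].
    by rewrite -[u]scale1r; apply: Plin.
  by apply: (PU i) => //; apply: vU.
have PV : forall y, y \in V -> P y.
  by apply/Psum => i i0; apply/Pline/PX.
have PW : forall y, y \in W -> P y.
  by apply/Psum => i i0; apply/Psum => j j0; apply/Pline/PXX.
have VW_ideal : lie_ideal (V + W)%VS.
  move=> x y yVW; rewrite (coordX x) linear_sumlz memv_suml // => i _.
  by rewrite linearZl_LR memvZ ?VW_basis.
(* If every eigenvalue vanished, [h] would be central, hence zero. *)
have [i i0] : exists i, lam i != 0.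
  apply/existsP; apply: contraNT h0 => /existsPn lam0.
  apply/eqP/centre_trivial => z; rewrite (coordX z) linear_sumlz big1 // => i _.
  rewrite linearZl_LR /= lieC X_eig; move/negPn/eqP: (lam0 i) => ->.
  by rewrite scale0r oppr0 scaler0.
have VW_full : (V + W)%VS = fullv.
  apply: (ideal_full (x := X`_i)) => //.
    by apply/(subvP (addvSl _ _))/X_V.
  exact: basis_neq0 X_basis.
move=> z; have: z \in (V + W)%VS by rewrite VW_full memvf.
case/memv_addP=> u /PV Pu [w /PW Pw ->].
by rewrite -[u]scale1r; apply: Plin.
Qed.

End SimpleLieAlgebra.

(** * The Bianchi identity, its symmetries and its pairing with the Killing form *)

Section Curvature.
Variables (F : numFieldType) (g : lieAlgType F).
Implicit Types (x y z u v w : g) (f : g -> g -> g) (s : g -> g -> F).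

Definition bianchi f s := forall x y z,
  0 = [[f x y, z]] + [[f y z, x]] + [[f z x, y]]
      + s x y *: z + s y z *: x + s z x *: y.

(** Stated for plain functions, so that the g-action produces new solutions without repackaging.
    Linearity of [s] in its second argument follows by antisymmetry. *)
Definition curvature f s :=
  [/\ forall x y, f x y = - f y x, forall y, scalar (s^~ y),
      forall x y, s x y = - s y x & bianchi f s].

Lemma sub4_eq0 (V : zmodType) (r1 r2 r3 r4 r : V) :
  0 = r1 -> 0 = r2 -> 0 = r3 -> 0 = r4 -> r = r1 - r2 - r3 - r4 -> 0 = r.
Proof. by move=> <- <- <- <-; rewrite !subr0. Qed.

(** The Bianchi expression is g-equivariant: its value on the transformed pair is [[[u, -]]] of the
    identity at x, y, z minus the three identities in which [u] acts on one argument. *)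
Lemma curvature_act u f s : curvature f s ->
  curvature (fun x y => [[u, f x y]] - f [[u, x]] y - f x [[u, y]])
            (fun x y => - s [[u, x]] y - s x [[u, y]]).
Proof.
case=> f_alt s_lin s_alt fs; split=> [x y|y k x x'|x y|x y z].
- rewrite (f_alt x y) (f_alt [[u, x]]) (f_alt x [[u, y]]) linearNr.
  by rewrite !opprD !opprK -!addrA; congr (_ + _); rewrite addrC.
- have sD p q : s (k *: p + q) y = k * s p y + s q y by apply: s_lin.
  have -> : s (k *: x + x') [[u, y]] = k * s x [[u, y]] + s x' [[u, y]].
    exact: s_lin.
  by rewrite linearDr linearZr_LR sD; ring.
- by rewrite (s_alt [[u, x]]) (s_alt x [[u, y]]); ring.
have e0 := congr1 (lie u) (fs x y z); rewrite linear0r in e0.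
apply: (sub4_eq0 e0 (fs [[u, x]] y z) (fs x [[u, y]] z) (fs x y [[u, z]])).
rewrite !linearDr !linearZr_LR /= !(lie_derivation u) !linearBl.
(* The vector identity is checked one coordinate at a time, with an abstract linear coordinate [c],
   so that [ring] applies. *)
apply/(can_inj (rVofK (vbasisP {:g})))/rowP => i.
have [c [cN cD cZ cE] ] : exists c : g -> F,
    [/\ {morph c : p / - p}, {morph c : p q / p + q},
        forall k p, c (k *: p) = k * c p
      & forall p, rVof (vbasis {:g}) p 0 i = c p].
  exists (fun p => rVof (vbasis {:g}) p 0 i).
  by split=> [p|p q|k p|//]; rewrite (linearN, linearD, linearZ) ?mxE.
rewrite !cE !(cD, cN, cZ); ring.
Qed.

Lemma bianchi_killing f s x y z w : bianchi f s ->
  killing (f x y) [[z, w]] + killing (f y z) [[x, w]] + killing (f z x) [[y, w]]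
  = - (s x y * killing z w + s y z * killing x w + s z x * killing y w).
Proof.
move=> fs; rewrite -!killingA; apply/eqP; rewrite -addr_eq0 eq_sym.
have := congr1 (killing w) (fs x y z).
by rewrite !linearD /= !linearZ raddf0 /= !(killingC w) !addrA => <-.
Qed.

(** The six unknowns are the vertices of an octahedron and the four equations are faces meeting only
    in vertices. Each unknown lies on two faces, and the signs cancel all but the opposite vertices
    [a] and [a']. *)
Lemma octahedron (a b c a' b' c' r1 r2 r3 r4 : F) :
  a + b + c = r1 -> - b - a' - c' = r2 -> a' - - b' - - c = r3 ->
  - b' - a - c' = r4 -> 2 * (a - a') = r1 + r2 - r3 - r4.
Proof. by move=> <- <- <- <-; ring. Qed.

(* The octahedron argument for the pair symmetry of a Riemann tensor. *)
Lemma pair_symmetry f s x y z w : curvature f s ->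
  killing (f x y) [[z, w]] - killing (f z w) [[x, y]]
  = - (s y z * killing x w + s z x * killing y w
       + s w y * killing z x + s x w * killing y z).
Proof.
case=> f_alt _ s_alt fs.
have E1 := bianchi_killing x y z w fs.
have E2 := bianchi_killing y z w x fs.
have E3 := bianchi_killing z w x y fs.
have E4 := bianchi_killing w x y z fs.
have negl (p q r : g) : killing (- p) [[q, r]] = - killing p [[q, r]].
  by rewrite killingC linearN /= killingC.
have negr (p q r : g) : killing p [[q, r]] = - killing p [[r, q]].
  by rewrite (lieC q) linearN.
rewrite (f_alt w y) !negl (negr _ w x) (negr _ y x) in E2.
rewrite (f_alt x z) (f_alt w x) !negl (negr _ z y) (negr _ w y) in E3.
rewrite (f_alt w x) !negl (negr _ w z) (negr _ x z) in E4.
rewrite (killingC w x) in E2; rewrite (killingC z y) (killingC w y) in E3.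
rewrite (killingC w z) (killingC x z) in E4.
have two_neq0 : 2 != 0 :> F by rewrite pnatr_eq0.
apply: (mulfI two_neq0); rewrite (octahedron E1 E2 E3 E4).
rewrite (killingC y x) (s_alt x w) (s_alt y w) (s_alt x z).
generalize (killing x y) (killing x w) (killing y w) (killing z x) (killing z w).
generalize (killing y z) (s x y) (s y z) (s z w) (s z x) (s w y) (s w x).
by move=> *; ring.
Qed.

Lemma commuting_pairs f s x y z w : curvature f s ->
  [[x, y]] = 0 -> [[z, w]] = 0 ->
  s y z * killing x w + s z x * killing y w + s w y * killing z x
  + s x w * killing y z = 0.
Proof.
move=> fs xy zw; have /eqP := pair_symmetry x y z w fs.
by rewrite xy zw !linear0 subr0 eq_sym oppr_eq0 => /eqP.
Qed.

(** A single Bianchi identity paired with [w]: here the terms in [f] vanish because [w] commutes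
    with the other three elements. *)
Lemma commuting_triple f s x y z w : curvature f s ->
  [[x, w]] = 0 -> [[y, w]] = 0 -> [[z, w]] = 0 ->
  s x y * killing z w + s y z * killing x w + s z x * killing y w = 0.
Proof.
case=> _ _ _ fs xw yw zw; have /eqP := bianchi_killing x y z w fs.
by rewrite xw yw zw !linear0 !addr0 eq_sym oppr_eq0 => /eqP.
Qed.

End Curvature.

(** * Weights of a self-centralizing toral subalgebra of rank at least 2 *)

Section Toral.
Variables (F : numFieldType) (g : lieAlgType F) (H : {vspace g}).
Implicit Types (x y z u v h t : g) (a b c d : g -> F).

(** Weights are functionals on all of g, of which only the values on [H] matter. The zero vector is
    allowed for every weight, so a bracket of weight vectors never has to be shown non-zero. *)
Definition weight_vector a x :=
  scalar a /\ forall h, h \in H -> [[h, x]] = a h *: x.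

Lemma scalar_at0 a : scalar a -> a 0 = 0.
Proof.
by move=> a_lin; have := a_lin (- 1) 0 0; rewrite scaler0 addr0 mulN1r addNr.
Qed.

Lemma scalar_atZ a k x : scalar a -> a (k *: x) = k * a x.
Proof. by move=> a_lin; rewrite -[k *: x]addr0 a_lin scalar_at0 ?addr0. Qed.

Lemma scalar_atB a k x y : scalar a -> a (x - k *: y) = a x - k * a y.
Proof. by move=> a_lin; rewrite -scaleNr addrC a_lin mulNr addrC. Qed.

Lemma weight_lie a b x y : weight_vector a x -> weight_vector b y ->
  weight_vector (fun h => a h + b h) [[x, y]].
Proof.
move=> [a_lin ax] [b_lin bx]; split=> [k u v|h hH].
  by rewrite a_lin b_lin mulrDr addrACA.
by apply: eig_lie; [apply: ax | apply: bx].
Qed.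

(** By invariance [h] acts skewly, so [(a h + b h) * killing x y] vanishes. *)
Lemma killing_weight a b x y h : weight_vector a x -> weight_vector b y ->
  h \in H -> a h + b h != 0 -> killing x y = 0.
Proof.
move=> [_ ax] [_ bx] hH ab; apply: (mulfI ab); rewrite mulr0.
have := killing_lieC h x y; rewrite ax // bx // killingC !linearZ /= killingC.
by rewrite mulrDl => ->; rewrite addNr.
Qed.

Hypothesis g_simple : lie_simple g.
Hypothesis H_abelian : lie_abelian H.
Hypothesis H_self_centralizing :
  forall x, (forall h, h \in H -> [[h, x]] = 0) -> x \in H.
Hypothesis H_rank : (1 < \dim H)%N.
Hypothesis killing_nondeg : forall x, (forall y, killing x y = 0) -> x = 0.
Variables (X : (\dim {:g}).-tuple g) (lam : 'I_(\dim {:g}) -> g -> F).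
Hypothesis X_basis : basis_of {:g} X.
Hypothesis X_weight : forall i : 'I_(\dim {:g}), weight_vector (lam i) X`_i.

Let X_neq0 (i : 'I_(\dim {:g})) : X`_i != 0.
Proof. exact: basis_neq0 X_basis. Qed.

(** The induction principle for all later extensions from weight vectors to g. The choice of [h]
    decides which weights count as generators. *)
Lemma weight_gen h (P : g -> Prop) : h \in H -> h != 0 ->
    P 0 -> (forall k x y, P x -> P y -> P (k *: x + y)) ->
    (forall a x, weight_vector a x -> x != 0 -> a h != 0 -> P x) ->
    (forall a b x y, weight_vector a x -> weight_vector b y ->
       x != 0 -> y != 0 -> a h != 0 -> b h != 0 -> P [[x, y]]) ->
  forall z, P z.
Proof.
move=> hH h0 P0 Plin P1 P2.
apply: (eig_gen g_simple X_basis (lam := fun i => lam i h)) h0 P0 Plin _ _.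
- by move=> i; apply: (X_weight i).2.
- by move=> i i0; apply: (P1 (lam i)); rewrite ?X_neq0.
- by move=> i j i0 j0; apply: (P2 (lam i) (lam j)); rewrite ?X_neq0.
Qed.

Lemma weight_vector_toral h : h \in H -> weight_vector (fun=> 0) h.
Proof.
move=> hH; split=> [k x y|h' h'H]; first by rewrite mulr0 addr0.
by rewrite scale0r H_abelian.
Qed.

Lemma killing_toral_root a x h h' : weight_vector a x -> h \in H ->
  h' \in H -> a h' != 0 -> killing h x = 0.
Proof.
move=> ax hH h'H a0.
by apply: (killing_weight (weight_vector_toral hH) ax h'H); rewrite add0r.
Qed.

(** A basis weight vector not orthogonal to [h] must have weight zero on [H], so it lies in [H] by
    self-centralization. *)
Lemma toral_nondeg h : h \in H -> h != 0 ->
  exists2 h', h' \in H & killing h h' != 0.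
Proof.
move=> hH h0; have [i hi] : exists i : 'I_(\dim {:g}), killing h X`_i != 0.
  apply/existsP; apply: contraNT h0 => /existsPn hX; apply/eqP.
  apply: killing_nondeg => y; rewrite (coord_basis X_basis (memvf y)).
  rewrite linear_sum big1 // => i _; rewrite linearZ /=.
  by move/negPn/eqP: (hX i) => ->; rewrite mulr0.
exists X`_i => //; apply: H_self_centralizing => h' h'H.
rewrite (X_weight i).2 //; apply: contraNeq hi => i0.
apply/eqP/(killing_toral_root (X_weight i) hH h'H).
by apply: contraNneq i0 => ->; rewrite scale0r.
Qed.

Lemma toral_neq0 : exists2 h, h \in H & h != 0.
Proof. by exists (vpick H); rewrite ?memv_pick // vpick0 -dimv_eq0 -lt0n ltnW. Qed.

(** Here rank at least 2 enters: a functional on [H] has a non-trivial kernel. *)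
Lemma toral_ker a : scalar a -> exists h, [/\ h \in H, h != 0 & a h = 0].
Proof.
move=> a_lin; have [h1 h1H h1_neq0] := toral_neq0.
have [a1|a1] := eqVneq (a h1) 0; first by exists h1.
have /subvPn [h2 h2H h2_notin] : ~~ (H <= <[h1]>)%VS.
  by apply: contraL H_rank => /dimvS; rewrite dim_vline h1_neq0 -leqNgt.
exists (h2 - (a h2 / a h1) *: h1); split.
- by rewrite memvB // memvZ.
- apply: contraNneq h2_notin => /eqP; rewrite subr_eq0 => /eqP ->.
  by rewrite memvZ ?memv_line.
- by rewrite scalar_atB // divfK // subrr.
Qed.

(** A basis vector pairing non-trivially with [x] has the opposite weight, so its bracket with [x]
    lies in [H]. By invariance this bracket, suitably scaled, represents [a] through the Killing
    form. *)
Lemma weight_dual a x : weight_vector a x -> x != 0 ->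
  exists2 t, t \in H & forall h, h \in H -> killing t h = a h.
Proof.
move=> ax x0.
have [i xi] : exists i : 'I_(\dim {:g}), killing x X`_i != 0.
  apply/existsP; apply: contraNT x0 => /existsPn hX; apply/eqP.
  apply: killing_nondeg => y; rewrite (coord_basis X_basis (memvf y)).
  rewrite linear_sum big1 // => i _; rewrite linearZ /=.
  by move/negPn/eqP: (hX i) => ->; rewrite mulr0.
have opp h : h \in H -> a h + lam i h = 0.
  move=> hH; apply: contraNeq xi => ai.
  by apply/eqP/(killing_weight ax (X_weight i) hH).
exists ((killing x X`_i)^-1 *: [[x, X`_i]]).
  apply/memvZ/H_self_centralizing => h hH.
  by rewrite (weight_lie ax (X_weight i)).2 // opp // scale0r.
move=> h hH; rewrite killingC linearZ /= (killingC h) killingA lieC raddfN /=.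
rewrite (X_weight i).2 // linearZ /=; move/eqP: (opp h hH).
by rewrite addr_eq0 => /eqP ->; rewrite mulrN mulrC mulfK.
Qed.


(** * Vanishing of sigma *)

Lemma curvature_root_pair f s a b x y t : curvature f s ->
  weight_vector a x -> weight_vector b y ->
  t \in H -> (forall h, h \in H -> killing t h = b h) -> a t != 0 ->
  killing x y = 0 -> s x y = 0.
Proof.
move=> fs ax by_ tH tb at_neq0 xy.
have [h hH bh] : exists2 h, h \in H & b h = 1.
  have t0 : t != 0 by apply: contraNneq at_neq0 => ->; rewrite (scalar_at0 ax.1).
  have [h hH th] := toral_nondeg tH t0.
  exists ((killing t h)^-1 *: h); first by rewrite memvZ.
  by rewrite -tb ?memvZ // linearZ /= mulVf.
(* The aim is q in ker a and p in ker b with [killing q p != 0]: [commuting_pairs] for q, x, y, p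
   then reduces to [s x y * killing q p = 0]. *)
have [q [qH q0 aq] ] := toral_ker ax.1.
pose q' := q - killing h q *: t.
have q'H : q' \in H by rewrite memvB ?memvZ.
(* Since [a q = 0] and [a t != 0], a non-zero [q] is no multiple of [t], the direction orthogonal to
   ker b. *)
have q'0 : q' != 0.
  apply: contraNneq q0 => q'0; have /eqP := scalar_atB (killing h q) q t ax.1.
  rewrite -/q' q'0 (scalar_at0 ax.1) aq sub0r eq_sym oppr_eq0 mulf_eq0.
  rewrite (negPf at_neq0) orbF => /eqP hq.
  by move: q'0; rewrite /q' hq scale0r subr0 => ->.
have [k kH qk] := toral_nondeg q'H q'0.
(* Correcting [k] into ker b by means of [h] turns [killing q' k] into [killing q p]. *)
pose p := k - b k *: h.
have pH : p \in H by rewrite memvB ?memvZ.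
have bp : b p = 0 by rewrite (scalar_atB _ _ _ by_.1) bh mulr1 subrr.
have qp : killing q p != 0.
  suff -> : killing q p = killing q' k by [].
  rewrite (killingC q') /q' /p !linearB !linearZ /= (killingC k t) tb //.
  by rewrite (killingC k q) (killingC h q) mulrC.
have xq : [[q, x]] = 0 by rewrite ax.2 // aq scale0r.
have yp : [[y, p]] = 0 by rewrite lieC by_.2 // bp scale0r oppr0.
have := commuting_pairs fs xq yp.
rewrite xy (killingC x p) (killing_toral_root ax pH tH at_neq0).
have bh0 : b h != 0 by rewrite bh oner_neq0.
rewrite (killingC y q) (killing_toral_root by_ qH hH bh0).
by rewrite !mulr0 !addr0 => /eqP; rewrite mulf_eq0 (negPf qp) orbF => /eqP.
Qed.

(** The weights are opposite, so any [w] in ker a commutes with both vectors and with [H]. For z in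
    [H] not orthogonal to [w], [commuting_triple] leaves only [s x y * killing z w]. *)
Lemma curvature_opposite_pair f s a b x y h : curvature f s ->
  weight_vector a x -> weight_vector b y -> h \in H -> a h != 0 ->
  killing x y != 0 -> s x y = 0.
Proof.
move=> fs ax by_ hH ah xy.
have ab k : k \in H -> a k + b k = 0.
  by move=> kH; apply: contraNeq xy => abk; apply/eqP/(killing_weight ax by_ kH).
have bh : b h != 0.
  by apply: contraNneq ah => bh; have := ab h hH; rewrite bh addr0 => ->.
have [w [wH w0 aw] ] := toral_ker ax.1.
have bw : b w = 0 by have := ab w wH; rewrite aw add0r.
have [z zH wz] := toral_nondeg wH w0.
have xw : [[x, w]] = 0 by rewrite lieC ax.2 // aw scale0r oppr0.
have yw : [[y, w]] = 0 by rewrite lieC by_.2 // bw scale0r oppr0.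
have := commuting_triple fs xw yw (H_abelian zH wH).
rewrite !(killingC _ w) (killing_toral_root ax wH hH ah).
rewrite (killing_toral_root by_ wH hH bh) !mulr0 !addr0 => /eqP.
by rewrite mulf_eq0 (negPf wz) orbF => /eqP.
Qed.

Lemma curvature_nonorthogonal f s a b x y t : curvature f s ->
  weight_vector a x -> weight_vector b y ->
  t \in H -> (forall h, h \in H -> killing t h = b h) -> a t != 0 ->
  s x y = 0.
Proof.
move=> fs ax by_ tH tb at_neq0; have [xy|xy] := eqVneq (killing x y) 0.
  exact: (curvature_root_pair fs ax by_ tH tb).
exact: (curvature_opposite_pair fs ax by_ tH).
Qed.

(** Induction on [z] with [weight_gen] at the dual [t] of [b]: the generating weights are then
    exactly those not orthogonal to [b]. Brackets of generators are handled by passing to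
    transformed solutions. *)
Lemma curvature_root f s b y h z : curvature f s ->
  weight_vector b y -> y != 0 -> h \in H -> b h != 0 -> s z y = 0.
Proof.
move=> fs by_ y0 hH bh; have [t tH tb] := weight_dual by_ y0.
have t0 : t != 0.
  apply: contraNneq bh => t0; rewrite -tb // t0 killingC linear0 //.
move: f s fs z.
have base f s a x : curvature f s -> weight_vector a x -> a t != 0 -> s x y = 0.
  by move=> fs ax; apply: (curvature_nonorthogonal fs ax by_ tH tb).
move=> f s fs z; have [_ s_lin s_alt _] := fs.
apply: (weight_gen tH t0 (P := fun z => s z y = 0)) => [|k x x' sx sx'|a x ax _|].
- exact: (scalar_at0 (s_lin y)).
- by have /= -> := s_lin y k x x'; rewrite sx sx' mulr0 addr0.
- exact: (base _ _ _ _ fs ax).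
move=> c d u v cu dv u0 v0 ct dt.
have [cdt|cdt] := eqVneq (c t + d t) 0; last first.
  by apply: (base _ _ _ _ fs (weight_lie cu dv)).
(* Acting by u gives s [u,v] y = - s v [u,y], acting by v gives s [u,v] y =
   s u [v,y]; if neither right-hand side vanished by orthogonality, then
   c t = d t, contradicting c t + d t = 0. *)
have [tc tcH tcE] := weight_dual cu u0.
have [td tdH tdE] := weight_dual dv v0.
have [cbd|cbd] := eqVneq (c td + b td) 0; last first.
  have := base _ _ _ _ (curvature_act u fs) dv dt.
  rewrite /= (s_alt v)
    (curvature_nonorthogonal fs (weight_lie cu by_) dv tdH tdE cbd).
  by rewrite !oppr0 addr0 => /eqP; rewrite oppr_eq0 => /eqP.
have [dbc|dbc] := eqVneq (d tc + b tc) 0; last first.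
  have := base _ _ _ _ (curvature_act v fs) cu ct.
  rewrite /= (s_alt u)
    (curvature_nonorthogonal fs (weight_lie dv by_) cu tcH tcE dbc).
  rewrite lieC -scaleN1r (scalar_atZ _ _ (s_lin y)) mulN1r.
  by rewrite !(oppr0, opprK, addr0).
have ctd : c td = d tc by rewrite -tcE // -tdE // killingC.
have btc : b tc = c t by rewrite -tb // -tcE // killingC.
have btd : b td = d t by rewrite -tb // -tdE // killingC.
have ctdt : c t = d t by apply: (addrI (d tc)); rewrite -btc dbc -ctd -btd cbd.
by move/eqP: cdt; rewrite -ctdt -mulr2n mulrn_eq0 (negPf ct).
Qed.

(** Root vectors are settled for every solution at once; applying this to the solution transformed
    by [u] gives [s [[u, v]] y = - s v [[u, y]] = 0]. *)
Lemma curvature_scalar_part f s : curvature f s -> forall x y, s x y = 0.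
Proof.
move=> fs x y.
have [h hH h0] := toral_neq0.
move: x f s fs y.
have base a x : weight_vector a x -> x != 0 -> a h != 0 ->
    forall f s, curvature f s -> forall y, s x y = 0.
  move=> ax x0 ah f s fs y; have [_ _ s_alt _] := fs.
  by rewrite s_alt (curvature_root y fs ax x0 hH ah) oppr0.
apply: (weight_gen hH h0 (P := fun x => forall f s, _ -> _)) => [f s fs y|||].
- by have [_ s_lin _ _] := fs; apply: (scalar_at0 (s_lin y)).
- move=> k x x' sx sx' f s fs y; have [_ s_lin _ _] := fs.
  by have /= -> := s_lin y k x x'; rewrite (sx f s fs) (sx' f s fs) mulr0 addr0.
- exact: base.
move=> a b u v au bv u0 v0 au0 bv0 f s fs y.
have := base b v bv v0 bv0 _ _ (curvature_act u fs) y.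
rewrite /= (base b v bv v0 bv0 _ _ fs) subr0 => /eqP.
by rewrite oppr_eq0 => /eqP.
Qed.

(** * An endomorphism whose composite with the bracket satisfies the Bianchi identity is scalar *)

Section BracketPart.
Variable phi : 'End(g).
Hypothesis phi_jacobi : forall x y z,
  [[phi [[x, y]], z]] + [[phi [[y, z]], x]] + [[phi [[z, x]], y]] = 0.
Hypothesis phi_sym : forall x y, killing (phi x) y = killing x (phi y).

(** In the identity for k, h, y the brackets [[[k, h]]] and [[[y, k]]] vanish, which leaves [b h]
    times the claim. *)
Lemma phi_ker_weight b y h k : weight_vector b y -> h \in H -> b h != 0 ->
  k \in H -> b k = 0 -> [[k, phi y]] = 0.
Proof.
move=> by_ hH bh kH bk; have := phi_jacobi k h y.
rewrite (H_abelian kH hH) linear0 linear0l add0r (by_.2 h) // (lieC y) (by_.2 k) // bk.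
rewrite scale0r oppr0 linear0 linear0l addr0 linearZ /= linearZl_LR /= lieC.
by move/eqP; rewrite scaler_eq0 (negPf bh) oppr_eq0 => /eqP.
Qed.

Lemma phi_weight_relation a b x y r : weight_vector a x -> weight_vector b y ->
  r \in H -> a r = 0 -> b r = 1 -> [[phi y, x]] = [[phi [[x, y]], r]].
Proof.
move=> ax by_ rH ar br; have /eqP := phi_jacobi x y r.
rewrite (ax.2 r) // ar scale0r linear0 linear0l addr0 (lieC y) (by_.2 r) // br scale1r.
by rewrite linearN linearNl subr_eq0 => /eqP.
Qed.

(** [q] and [h] witness that the weights are independent on [H], so there is a pair dual to them. *)
Lemma weight_pair_basis a b x y h q : weight_vector a x -> weight_vector b y ->
  h \in H -> b h != 0 -> q \in H -> b q = 0 -> a q != 0 ->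
  exists p r, [/\ p \in H, r \in H, a p = 1 /\ b p = 0 & a r = 0 /\ b r = 1].
Proof.
move=> [a_lin _] [b_lin _] hH bh qH bq aq.
exists ((a q)^-1 *: q), ((b h)^-1 *: (h - (a h / a q) *: q)); split.
- by rewrite memvZ.
- by rewrite memvZ // memvB // memvZ.
- by rewrite !scalar_atZ // bq mulr0 mulVf.
- by rewrite !scalar_atZ // !scalar_atB // bq mulr0 subr0 mulVf // divfK // subrr mulr0.
Qed.

Lemma phi_weight b y h : weight_vector b y -> h \in H -> b h != 0 ->
  weight_vector b (phi y).
Proof.
move=> by_ hH bh; split; first exact: by_.1.
have b_lin := by_.1.
pose h0 := (b h)^-1 *: h.
have h0H : h0 \in H by rewrite memvZ.
have bh0 : b h0 = 1 by rewrite scalar_atZ // mulVf.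
have [q [qH q0 bq] ] := toral_ker b_lin.
(* Since ker b already kills [phi y], the only possible defect is [v]. It is shown to be central. *)
pose v := phi y - [[h0, phi y]].
have v_root a x : weight_vector a x -> a q != 0 -> [[x, v]] = 0.
  move=> ax aq; have [p [r [pH rH [ap bp] [ar br] ] ] ] :=
    weight_pair_basis ax by_ hH bh qH bq aq.
  (* [a + b] vanishes at [h1], so [h1] kills [phi [[x, y]]], while [h1 + h0] lies in ker b. Applying
     ad h1 to [phi_weight_relation] then gives [[[v, x]] = 0]. *)
  pose h1 := p - r.
  have h1H : h1 \in H by rewrite memvB.
  have [ah1 bh1] : a h1 = 1 /\ b h1 = -1.
    rewrite /h1 -[r]scale1r (scalar_atB _ _ _ ax.1) scalar_atB // ap ar bp br.
    by rewrite mulr0 subr0 mulr1 sub0r.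
  have h1_phiy : [[h1, phi y]] = - [[h0, phi y]].
    apply/eqP; rewrite -addr_eq0 -linearDl; apply/eqP.
    apply: (phi_ker_weight by_ hH bh); first by rewrite memvD.
    by rewrite -[h1]scale1r b_lin bh1 bh0 mul1r addNr.
  have h1_phixy : [[h1, phi [[x, y]]]] = 0.
    apply: (phi_ker_weight (weight_lie ax by_) rH) => //.
      by rewrite ar br add0r oner_neq0.
    by rewrite ah1 bh1 subrr.
  have := congr1 (lie h1) (phi_weight_relation ax by_ rH ar br).
  rewrite !(lie_derivation h1) h1_phixy linear0l (H_abelian h1H rH) linear0r addr0.
  rewrite h1_phiy (ax.2 h1) // ah1 scale1r -linearDl => vx.
  by rewrite lieC /v addrC vx oppr0.
have v0 : v = 0.
  apply: (centre_trivial g_simple) => z; move: z.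
  apply: (weight_gen qH q0 (P := fun z => [[z, v]] = 0)) => [|k x x' vx vx'|a x ax _|].
  - exact: linear0l.
  - by rewrite linearPl /= vx vx' scaler0 addr0.
  - exact: v_root ax.
  move=> a c x z ax cz _ _ aq cq; have := lie_derivation x z v.
  by rewrite (v_root _ _ ax aq) (v_root _ _ cz cq) !linear0r addr0.
move=> k kH; have := phi_ker_weight (k := k - b k *: h0) by_ hH bh.
rewrite memvB ?memvZ // scalar_atB // bh0 mulr1 subrr => /(_ isT erefl)/eqP.
rewrite linearBl subr_eq0 => /eqP ->; rewrite linearZl_LR /=; congr (_ *: _).
by apply/eqP; rewrite eq_sym -subr_eq0 -/v v0.
Qed.

(** [phi [[x, y]]] has weight a + b, which is 1 at both [p] and [r], so the toral element in
    [phi_weight_relation] acts on it as the identity. *)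
Lemma phi_independent a b x y h q : weight_vector a x -> weight_vector b y ->
  h \in H -> b h != 0 -> q \in H -> b q = 0 -> a q != 0 ->
  [[phi x, y]] = phi [[x, y]] /\ [[x, phi y]] = phi [[x, y]].
Proof.
move=> ax by_ hH bh qH bq aq.
have [p [r [pH rH [ap bp] [ar br] ] ] ] := weight_pair_basis ax by_ hH bh qH bq aq.
have phixy : weight_vector (fun h => a h + b h) (phi [[x, y]]).
  by apply: (phi_weight (weight_lie ax by_) rH); rewrite ar br add0r oner_neq0.
split.
  rewrite (phi_weight_relation by_ ax pH bp ap) (lieC y x) linearN linearNl.
  by rewrite -lieC phixy.2 // ap bp addr0 scale1r.
rewrite lieC (phi_weight_relation ax by_ rH ar br) (lieC _ r) phixy.2 // ar br.
by rewrite add0r scale1r opprK.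
Qed.

(** With [q] in ker a, every weight non-zero at [q] is independent of [a]. For a bracket of two
    generators the claim follows from the identity for [phi] and the Jacobi identity. *)
Lemma phi_exchange a x h z : weight_vector a x -> h \in H -> a h != 0 ->
  [[phi z, x]] = [[z, phi x]].
Proof.
move=> ax hH ah; have [q [qH q0 aq] ] := toral_ker ax.1.
move: z; apply: (weight_gen qH q0 (P := fun z => [[phi z, x]] = [[z, phi x]])).
- by rewrite linear0 !linear0l.
- by move=> k y y' yx y'x; rewrite linearP !linearPl /= yx y'x.
- by move=> b y by_ _ bq; have [-> ->] := phi_independent by_ ax hH ah qH aq bq.
move=> c d u v cu dv _ _ cq dq.
have [_ ux] := phi_independent cu ax hH ah qH aq cq.
have [_ vx] := phi_independent dv ax hH ah qH aq dq.
have /eqP := phi_jacobi u v x; rewrite -vx (lieC x u) linearN /= -ux linearNl.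
rewrite -addrA addr_eq0 => /eqP ->; rewrite (lieC [[v, _]]) opprD !opprK.
by rewrite (lie_derivation u) (lieC [[u, phi x]]) addrK.
Qed.

(** For a root vector, [phi_exchange] is used once directly and once inside the Killing form, where
    symmetry of [phi] moves it across. Commuting with ad u and ad v implies commuting with ad of
    their bracket. *)
Lemma phi_commutes_ad x z : phi [[x, z]] = [[x, phi z]].
Proof.
have [h hH h0] := toral_neq0.
have root a y : weight_vector a y -> a h != 0 -> forall z, phi [[y, z]] = [[y, phi z]].
  move=> ay ah w.
  have -> : [[y, phi w]] = [[phi y, w]].
    by rewrite lieC (phi_exchange _ ay hH ah) -lieC.
  apply/eqP; rewrite -subr_eq0; apply/eqP/killing_nondeg => u.
  rewrite killingC linearB /= !(killingC u) phi_sym !killing_lieC.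
  by rewrite (lieC y (phi u)) (phi_exchange u ay hH ah) -lieC subrr.
move: x z; apply: (weight_gen hH h0 (P := fun x => forall z, _)).
- by move=> z; rewrite !linear0l linear0.
- by move=> k x x' px px' z; rewrite !linearPl /= linearP /= px px'.
- by move=> a x ax _; apply: root ax.
move=> a b u v au bv _ _ auh bvh z.
have lieE w : [[ [[u, v]], w]] = [[u, [[v, w]]]] - [[v, [[u, w]]]].
  by rewrite (lie_derivation u) addrK.
by rewrite !lieE linearB /= !(root _ _ au, root _ _ bv).
Qed.

Lemma phi_scalar : exists c : F, forall x, phi x = c *: x.
Proof.
have [h hH h0] := toral_neq0.
have [i lam_h] : exists i, lam i h != 0.
  apply/existsP; apply: contraNT h0 => /existsPn lam0.
  apply/eqP/(centre_trivial g_simple) => z.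
  rewrite (coord_basis X_basis (memvf z)) linear_sumlz big1 // => i _.
  rewrite linearZl_LR /= lieC (X_weight i).2 //; move/negPn/eqP: (lam0 i) => ->.
  by rewrite scale0r oppr0 scaler0.
have phihH : phi h \in H.
  by apply: H_self_centralizing => k kH; rewrite -phi_commutes_ad H_abelian ?linear0.
(* [phi h] lies in [H], so computing [phi [[h, X_i]]] as [[[phi h, X_i]]] makes [X_i] an eigenvector
   of [phi]; its eigenspace [K] is an ideal. *)
pose c := lam i (phi h) / lam i h; exists c.
have phiX : phi X`_i = c *: X`_i.
  apply: (scalerI lam_h); rewrite scalerA mulrC divfK //.
  rewrite -(X_weight i).2 // -linearZ /= -(X_weight i).2 //.
  by rewrite lieC linearN /= phi_commutes_ad -lieC.
pose K := lker (phi - c *: \1%VF).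
have KP x : (x \in K) = (phi x == c *: x).
  by rewrite memv_ker add_lfunE opp_lfunE scale_lfunE id_lfunE subr_eq0.
have K_full : K = fullv.
  apply: (ideal_full g_simple (x := X`_i)); last exact: X_neq0.
    move=> x y; rewrite !KP => /eqP phiy.
    by rewrite phi_commutes_ad phiy linearZ.
  by rewrite KP phiX.
by move=> x; apply/eqP; rewrite -KP K_full memvf.
Qed.

End BracketPart.

(** * Factoring f through the bracket *)

Lemma lie_perfect (P : g -> Prop) :
    P 0 -> (forall k x y, P x -> P y -> P (k *: x + y)) ->
    (forall x y, P [[x, y]]) ->
  forall z, P z.
Proof.
move=> P0 Plin Plie.
have [h hH h0] := toral_neq0.
apply: (weight_gen hH h0 P0 Plin) => [a x ax _ ah|]; last by move=> *; apply: Plie.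
have -> : x = (a h)^-1 *: [[h, x]] + 0 by rewrite addr0 ax.2 // scalerA mulVf ?scale1r.
by apply: Plin.
Qed.

(** On the tensor square the kernel of the bracket lies in that of [f]: pair symmetry moves the
    bracket onto the tensor, and brackets span g. *)
Lemma bracket_factor (f : {bilinear g -> g -> g}) :
  (forall x y z w, killing (f x y) [[z, w]] = killing (f z w) [[x, y]]) ->
  exists phi : 'End(g), forall x y, f x y = phi [[x, y]].
Proof.
move=> f_sym.
pose T : 'Hom('M[F]_(\dim {:g}), g) := linfun (bilinear_mx lie).
pose Tf : 'Hom('M[F]_(\dim {:g}), g) := linfun (bilinear_mx f).
have ker_f M : T M = 0 -> Tf M = 0.
  rewrite !lfunE /= => TM; apply: killing_nondeg; apply: lie_perfect.
  - exact: linear0.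
  - by move=> k y y' ky ky'; rewrite linearP /= ky ky' mulr0 addr0.
  move=> z w; rewrite killingC linear_sum /=.
  transitivity (killing (f z w) (bilinear_mx lie M)); last by rewrite TM linear0.
  rewrite linear_sum; apply: eq_bigr => i _; rewrite !linear_sum; apply: eq_bigr => j _.
  by rewrite !linearZ /= killingC f_sym.
(* [T^-1] is only a linear section of [T] over its image; its choice is immaterial because [Tf]
   vanishes on the kernel of [T]. *)
exists (Tf \o T^-1)%VF => x y.
pose M := \matrix_(i, j) (coord (vbasis {:g}) i x * coord (vbasis {:g}) j y).
have TM : T M = [[x, y]] by rewrite lfunE /= bilinear_mxE.
have TfM : Tf M = f x y by rewrite lfunE /= bilinear_mxE.
rewrite comp_lfunE -TM -TfM; apply/eqP; rewrite -subr_eq0 -linearB; apply/eqP.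
by apply: ker_f; rewrite linearB /= limg_lfunVK ?subrr // memv_img ?memvf.
Qed.

Lemma curvature_bracket (f : {bilinear g -> g -> g}) s : curvature f s ->
  (forall x y, s x y = 0) /\ exists c : F, forall x y, f x y = c *: [[x, y]].
Proof.
move=> fs; have s0 := curvature_scalar_part fs; split=> //.
have f_sym x y z w : killing (f x y) [[z, w]] = killing (f z w) [[x, y]].
  apply/eqP; rewrite -subr_eq0 (pair_symmetry x y z w fs) !s0.
  by rewrite !mul0r !addr0 oppr0.
have [phi phiE] := bracket_factor f_sym.
(* On brackets this is the pair symmetry of [f], and brackets span g in each argument. *)
have phi_sym x y : killing (phi x) y = killing x (phi y).
  move: x; apply: lie_perfect => [|k x x' px px'|x x'].
  - by rewrite linear0 !(killingC 0) !linear0.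
  - rewrite linearP /= !(killingC (_ + _)) !linearP /= !(killingC y) px px'.
    by rewrite !(killingC (phi y)).
  move: y; apply: lie_perfect => [|k y y' py py'|y y'].
  - by rewrite !linear0.
  - by rewrite !linearP /= py py'.
  by rewrite -!phiE f_sym killingC.
have phi_jacobi x y z :
    [[phi [[x, y]], z]] + [[phi [[y, z]], x]] + [[phi [[z, x]], y]] = 0.
  have [_ _ _ /(_ x y z)] := fs.
  by rewrite !s0 !scale0r !addr0 -!phiE => <-.
have [c phi_c] := phi_scalar phi_jacobi phi_sym.
by exists c => x y; rewrite phiE phi_c.
Qed.

End Toral.

(** * From Cartan subalgebra and Dynkin data to weight bases and a non-zero Killing value *)

Section CartanData.
Variables (F : numFieldType) (g : lieAlgType F).

Lemma ad_mx_diagonalizable (h : g) :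
  ad_diagonalizable h -> diagonalizable (ad_mx h).
Proof.
case=> X [X_basis X_eig]; pose e := vbasis {:g}.
have e_basis : basis_of fullv e by exact: vbasisP.
have PQ : mxof X e \1%VF *m mxof e X \1%VF = 1%:M.
  by rewrite -mxof_comp // comp_lfun1l mxof1 ?(basis_free X_basis).
have P_unit : mxof X e \1%VF \in unitmx by case/mulmx1_unit: PQ.
have D_diag : exists D, mxof X X (ad h) = diag_mx D.
  have X_i (i : 'I_(\dim {:g})) : exists a, [[h, X`_i]] == a *: X`_i.
    have [|a ha] := X_eig X`_i; first by apply: mem_nth; rewrite size_tuple.
    by exists a; apply/eqP.
  exists (\row_i xchoose (X_i i)); apply/row_matrixP => i.
  rewrite row_diag_mx rowE mul_mxof vecof_delta // adE mxE.
  have /eqP := xchooseP (X_i i); move: (xchoose _) => a ->.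
  by rewrite linearZ /= rVofE.
have [D XD] := D_diag.
exists (mxof X e \1%VF) => //; apply/similar_diagPex; exists D.
apply/similarP => //; rewrite -XD /ad_mx -!mxof_comp //.
by rewrite comp_lfun1l comp_lfun1r.
Qed.

(** The commuting diagonalizable matrices of a basis of [H] are diagonalized simultaneously; the
    rows of the transition matrix are the weight vectors. *)
Lemma weight_basis (H : {vspace g}) : lie_abelian H ->
    (forall h, h \in H -> ad_diagonalizable h) ->
  exists (X : (\dim {:g}).-tuple g) (lam : 'I_(\dim {:g}) -> g -> F),
    basis_of {:g} X /\
    forall i : 'I_(\dim {:g}), weight_vector H (lam i) X`_i.
Proof.
move=> H_abelian H_diag; pose e := vbasis {:g}.
have e_basis : basis_of fullv e by exact: vbasisP.
have [|P P_unit /allP /= PD] :=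
    (codiagonalizableP [seq ad_mx h | h <- vbasis H]).1.
  split=> [_ _ /mapP[h hH ->] /mapP[k kH ->]|_ /mapP[h hH ->] ].
    apply/eqP; rewrite -subr_eq0 -ad_mx_lie H_abelian ?vbasis_mem //.
    by rewrite /ad_mx !linear0.
  by apply/ad_mx_diagonalizable/H_diag/vbasis_mem.
pose X := [tuple vecof e (row i P) | i < \dim {:g}].
have XE (i : 'I_(\dim {:g})) : X`_i = vecof e (row i P).
  by rewrite -tnth_nth tnth_mktuple.
have X_basis : basis_of {:g} X.
  rewrite basisEfree subvf size_tuple leqnn !andbT; apply/freeP => k.
  have -> : \sum_i k i *: X`_i = vecof e ((\row_i k i) *m P).
    rewrite mulmx_sum_row linear_sum; apply: eq_bigr => i _.
    by rewrite XE linearZ /= mxE.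
  move/eqP; rewrite vecof_eq0 // => /eqP kP i.
  have /rowP/(_ i) : \row_i k i = 0 by rewrite -[LHS](mulmxK P_unit) kP mul0mx.
  by rewrite !mxE.
have X_eig (i : 'I_(\dim {:g})) h : h \in vbasis H -> exists a, [[h, X`_i]] = a *: X`_i.
  move=> hH.
  have /similar_diagPex [D /(similarP P_unit) PDP] := PD _ (map_f (@ad_mx _ _) hH).
  exists (D 0 i); rewrite XE -adE (hom_vecof _ e_basis) -row_mul PDP.
  by rewrite row_mul row_diag_mx -scalemxAl -rowE linearZ.
(* The eigenvalue is read off as a coordinate, which is linear in [h] on the whole of g. *)
exists X, (fun i h => coord X i [[h, X`_i]]); split=> // i.
split=> [k x y|h hH]; first by rewrite linearPl linearP.
have [a ha] : exists a, [[h, X`_i]] = a *: X`_i.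
  rewrite (coord_vbasis hH) linear_sumlz.
  have eig j : exists a, [[(vbasis H)`_j, X`_i]] == a *: X`_i.
    have [|jH] := ltnP j (\dim H); last first.
      by exists 0; rewrite nth_default ?size_tuple // linear0l scale0r.
    move=> jH; have [|a ->] := X_eig i (vbasis H)`_j; last by exists a.
    by apply: mem_nth; rewrite size_tuple.
  exists (\sum_(j < \dim H) coord (vbasis H) j h * xchoose (eig j)).
  rewrite scaler_suml; apply: eq_bigr => j _.
  rewrite linearZl_LR /= -scalerA; have /eqP := xchooseP (eig j).
  by move: (xchoose _) => a ->.
by rewrite ha linearZ /= coord_free ?(basis_free X_basis) // eqxx mulr1.
Qed.

Lemma killing_weight_basis (X : (\dim {:g}).-tuple g) (lam : 'I_(\dim {:g}) -> F) h :
  basis_of {:g} X -> (forall i : 'I_(\dim {:g}), [[h, X`_i]] = lam i *: X`_i) ->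
  killing h h = \sum_i lam i ^+ 2.
Proof.
move=> X_basis X_eig; pose e := vbasis {:g}.
have e_basis : basis_of fullv e by exact: vbasisP.
have PQ : mxof X e \1%VF *m mxof e X \1%VF = 1%:M.
  by rewrite -mxof_comp // comp_lfun1l mxof1 ?(basis_free X_basis).
have D_diag : mxof X X (ad h) = diag_mx (\row_i lam i).
  apply/row_matrixP => i.
  rewrite row_diag_mx rowE mul_mxof vecof_delta // adE mxE.
  by rewrite X_eig linearZ /= rVofE.
have -> : killing h h = \tr (mxof X X (ad h) *m mxof X X (ad h)).
  have adE' : ad_mx h = mxof e X \1%VF *m mxof X X (ad h) *m mxof X e \1%VF.
    by rewrite -!mxof_comp // comp_lfun1l comp_lfun1r.
  rewrite /killing adE' -!mulmxA mxtrace_mulC -!mulmxA.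
  by rewrite PQ mulmx1 (mulmxA (mxof X e _)) PQ mul1mx.
rewrite D_diag mulmx_diag mxtrace_diag; apply: eq_bigr => i _.
by rewrite !mxE expr2.
Qed.

(** Passes from weights as functionals on g to elements of [dual H], in which roots are
    expressed. *)
Lemma scalar_dual (H : {vspace g}) (a : g -> F) : scalar a ->
  exists A : dual H, forall u, A u = a (vsval u).
Proof.
move=> a_lin; pose a' : subvs_of H -> F^o := fun u => a (vsval u).
have a'_lin : linear a' by move=> k u v; rewrite /a' linearP a_lin.
pose m := GRing.isSemilinear.Build F (subvs_of H) F^o _ a'
  (GRing.semilinear_linear a'_lin).
pose A : {linear subvs_of H -> F^o} := HB.pack a' m.
by exists (linfun A) => u; rewrite lfunE.
Qed.

Lemma root_integral (H : {vspace g}) l (alpha : l.-tuple (dual H))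
    (u : subvs_of H) (A : dual H) : is_root_base alpha ->
    (forall i, exists m : int, tnth alpha i u = m%:~R) ->
  is_root A -> exists m : int, A u = m%:~R.
Proof.
case=> _ _ alpha_base /fin_all_exists[m alpha_u] /alpha_base[k A_k].
exists (if A == \sum_(i < l) (k i)%:R *: tnth alpha i
        then \sum_i (k i)%:Z * m i else - \sum_i (k i)%:Z * m i).
have sumE : (\sum_(i < l) (k i)%:R *: tnth alpha i) u
    = (\sum_i (k i)%:Z * m i)%:~R.
  rewrite sum_lfunE rmorph_sum; apply: eq_bigr => i _.
  by rewrite scale_lfunE alpha_u rmorphM.
case: eqVneq => [->|A_neq] //; case: A_k => [/eqP|->]; first by rewrite (negPf A_neq).
by rewrite opp_lfunE sumE rmorphN.
Qed.

(** All weights are integers at [u], so [killing u u] is a sum of integer squares. If it vanished,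
    [u] would be central; then [[[u, e]] = 2 e] forces e = 0 and u = [[[e, f]]] = 0, against
    [alpha u = 2]. *)
Lemma killing_coroot (H : {vspace g}) l (alpha : l.-tuple (dual H))
    (X : (\dim {:g}).-tuple g) (lam : 'I_(\dim {:g}) -> g -> F) i (u : subvs_of H) :
  basis_of {:g} X ->
  (forall i : 'I_(\dim {:g}), weight_vector H (lam i) X`_i) ->
  is_root_base alpha -> (forall j, exists m : int, tnth alpha j u = m%:~R) ->
  is_coroot (tnth alpha i) u ->
  killing (vsval u) (vsval u) != 0.
Proof.
move=> X_basis X_weight alpha_base alpha_u [alpha_u2 [e [f [e_alpha _ ef] ] ] ].
have uH : vsval u \in H by apply: subvsP.
have lam_int j : exists m : int, lam j (vsval u) = m%:~R.
  have [A AE] := scalar_dual H (X_weight j).1.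
  have [A0|A0] := eqVneq A 0; first by exists 0; rewrite -AE A0 lfunE.
  rewrite -AE; apply: (root_integral alpha_base) => //; split=> //.
  exists X`_j => [|v]; first exact: basis_neq0 X_basis.
  by rewrite (X_weight j).2 ?subvsP // AE.
have X_eig j := (X_weight j).2 _ uH.
rewrite (killing_weight_basis X_basis X_eig).
have lam_ge0 j : true -> 0 <= lam j (vsval u) ^+ 2.
  by move=> _; have [m ->] := lam_int j; rewrite -rmorphXn /= ler0z sqr_ge0.
apply/negP => /eqP/(psumr_eq0P lam_ge0) lam0.
have u_central z : [[vsval u, z]] = 0.
  rewrite (coord_basis X_basis (memvf z)) linear_sumr big1 // => j _.
  rewrite linearZr_LR X_eig; have /eqP := lam0 j isT.
  by rewrite sqrf_eq0 => /eqP ->; rewrite scale0r scaler0.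
have e0 : e = 0.
  apply/eqP; have /eqP := e_alpha u.
  by rewrite u_central alpha_u2 eq_sym scaler_eq0 pnatr_eq0.
have u0 : u = 0 by apply/val_inj; rewrite /= -ef e0 linear0l.
by move/eqP: alpha_u2; rewrite u0 linear0 eq_sym pnatr_eq0.
Qed.

Lemma simple_curvature (t : dynkin_type) (f : {bilinear g -> g -> g})
    (s : g -> g -> F) :
  lie_simple g -> has_dynkin_type g t -> (1 < dynkin_rank t)%N -> curvature f s ->
  (forall x y, s x y = 0) /\ exists c : F, forall x y, f x y = c *: [[x, y]].
Proof.
move=> g_simple [H [alpha [h [ [H_abelian H_self H_diag] ] ] ] ].
move=> alpha_base h_coroot cartan t_rank fs.
have H_rank : (1 < \dim H)%N.
  have [alpha_basis _ _] := alpha_base.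
  have := size_basis alpha_basis; rewrite dimvf => dimH.
  (* The simple roots form a basis of [dual H], whose dimension as a space of homomorphisms is
     [\dim H * 1]. *)
  by rewrite -dimH in t_rank; rewrite -[\dim H]muln1.
have [X [lam [X_basis X_weight] ] ] := weight_basis H_abelian H_diag.
pose i0 := Ordinal (ltnW t_rank).
have killing_h : killing (vsval (tnth h i0)) (vsval (tnth h i0)) != 0.
  apply: (killing_coroot X_basis X_weight alpha_base _ (h_coroot i0)) => j.
  by exists (cartan_entry t j i0).
have killing_nondeg := killing_nondegenerate g_simple killing_h.
exact: (curvature_bracket g_simple H_abelian H_self H_rank killing_nondeg
  X_basis X_weight fs).
Qed.

End CartanData.

Theorem theorem1p6 (R : realType) (g : lieAlgType R[i]) (t : dynkin_type)
    (g_simple : lie_simple g)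
    (g_type : has_dynkin_type g t)
    (t_type : type_not_A_neq2_nor_C t)
    (f : {bilinear g -> g -> g}) (f_alt : forall x : g, f x x = 0)
    (sigma : {biscalar g}) (sigma_alt : forall x : g, sigma x x = 0)
    (f_sigma : forall x y z : g,
      0 = [[f x y, z]] + [[f y z, x]] + [[f z x, y]]
          + sigma x y *: z + sigma y z *: x + sigma z x *: y) :
  (forall x y : g, sigma x y = 0) /\
  exists c : R[i], forall x y : g, f x y = c *: [[x, y]].
Proof.
have t_rank : (1 < dynkin_rank t)%N.
  case: t t_type {g_type} => [l|l|l|l|l||] //=.
  - by move=> ->.
  - exact: ltnW.
  - by move=> l4; apply: leq_trans l4.
  - by case/andP=> l6 _; apply: leq_trans l6.
apply: (simple_curvature g_simple g_type t_rank); split=> //.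
- move=> x y; have /eqP := f_alt (x + y); rewrite linearDl !linearDr /= !f_alt.
  by rewrite addr0 add0r addr_eq0 => /eqP.
- by move=> y k x x'; rewrite linearPl.
- move=> x y; have /eqP := sigma_alt (x + y).
  rewrite linearDl !linearDr /= !sigma_alt.
  by rewrite addr0 add0r addr_eq0 => /eqP.
Qed.
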